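(* Let $0\le k_{\min}<k_{\max}$, $\ell>0$, and $$s_{\mathrm{rat}}(v)=\frac{k_{\min}v+k_{\max}\ell}{v+\ell},\qquad v\ge0.$$ For any $\alpha_l(v)=\sigma v$ with $\sigma>0$, the product $\alpha(v)=s_{\mathrm{rat}}(v)\,\alpha_l(v)=s_{\mathrm{rat}}(v)\,\sigma v$ belongs to $\mathcal{K}_{cave}$ and is locally Lipschitz on $[0,\infty)$.
   Context: A function $\alpha:[0,\infty)\to[0,\infty)$ is of class $\mathcal{K}$ if it is continuous, strictly increasing and $\alpha(0)=0$. $\mathcal{K}_{cave}$ denotes the strictly concave class-$\mathcal{K}$ functions. *)

(* Defs.v *)
From HB Require Import structures.
From mathcomp Require Import all_boot all_order all_algebra.
From mathcomp Require Import all_classical all_reals all_analysis.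

Set Implicit Arguments.
Unset Strict Implicit.
Unset Printing Implicit Defensive.

Import Order.TTheory GRing.Theory Num.Theory.
Import numFieldNormedType.Exports.

Local Open Scope classical_set_scope.
Local Open Scope ring_scope.

(* A function [0, +oo) -> [0, +oo) is encoded as a total f : R -> R of
   which only the values on [0, +oo) matter: the predicates class_K and
   class_K_cave do not depend on f outside [0, +oo).  In particular continuity
   is that of the restriction, for the subspace topology on [0, +oo). *)

Definition nonnegatives (R : realType) : set R := [set x | 0 <= x].
Arguments nonnegatives : clear implicits.

Definition class_K (R : realType) (f : R -> R) : Prop :=
  [/\ set_fun (nonnegatives R) (nonnegatives R) f,
      {within nonnegatives R, continuous f},
      {in nonnegatives R &, {homo f : x y / x < y}}
    & f 0 = 0].

Definition strictly_concave_on (R : realType) (A : set R) (f : R -> R) : Prop :=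
  {in A &, forall x y : R, x != y -> forall t : R, 0 < t < 1 ->
    t * f x + (1 - t) * f y < f (t * x + (1 - t) * y)}.

Definition class_K_cave (R : realType) (f : R -> R) : Prop :=
  class_K f /\ strictly_concave_on (nonnegatives R) f.

(* The library's [locally [lipschitz _]] asks, at every point (x, y) of A * A,
   for a Lipschitz bound on the pairs of A * A close to (x, y).  For x = y this
   is the usual condition at x; for x != y it is local boundedness of the
   difference quotient near (x, y), which the usual condition at x and at y
   already implies. *)
Definition locally_lipschitz_on (R : realType) (A : set R) (f : R -> R) : Prop :=
  [locally [lipschitz f x | x in A]].

Definition s_rat (R : realType) (kmin kmax l v : R) : R :=
  (kmin * v + kmax * l) / (v + l).

(* Main.v *)
Require Import Defs.
From HB Require Import structures.
From mathcomp Require Import all_boot all_order all_algebra.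
From mathcomp Require Import all_classical all_reals all_analysis.
From mathcomp Require Import ring.
Import Order.TTheory GRing.Theory Num.Theory.
Import numFieldNormedType.Exports.
Local Open Scope classical_set_scope.
Local Open Scope ring_scope.

(** Partial fractions turn the product into an affine function minus a positive
    multiple of 1 / (v + l):
      alpha v = sigma * (kmin * v + c * l - c * l^2 / (v + l)),
      c = kmax - kmin > 0.
    Since 1 / (v + l) is strictly decreasing and strictly convex, alpha is
    strictly increasing and strictly concave.  Both facts are read off two exact
    identities, which avoid derivatives: the secant slope between x and y is
    [secant_slope] ([scaled_ratB]), which lies in ]0, sigma * kmax] on the
    half-line ([secant_slope_gt0], [secant_slope_le]), and the gap in the
    concavity inequality is an explicit positive fraction ([scaled_rat_gap]).  The upper bound on the slope makes
    alpha globally Lipschitz on the half-line, hence locally Lipschitz and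
    continuous there. *)

Definition scaled_rat {R : realType} (kmin kmax l sigma v : R) : R :=
  s_rat kmin kmax l v * (sigma * v).

Definition secant_slope {R : realType} (kmin kmax l sigma x y : R) : R :=
  sigma * (kmin + (kmax - kmin) * (l ^+ 2 / ((x + l) * (y + l)))).

(** For a reciprocal, 1 / (y + l) - 1 / (x + l) = (x - y) / ((x + l) * (y + l)),
    which gives the second term of the slope. *)
Lemma scaled_ratB (R : realType) (kmin kmax l sigma x y : R) :
  x + l != 0 -> y + l != 0 ->
  scaled_rat kmin kmax l sigma x - scaled_rat kmin kmax l sigma y =
  secant_slope kmin kmax l sigma x y * (x - y).
Proof.
move=> xl yl; rewrite /scaled_rat /secant_slope /s_rat.
by field; rewrite xl yl.
Qed.

(** The affine part of alpha has no gap, and the gap of a reciprocal is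
    t * (1 - t) * (x - y)^2 over the product of the three denominators. *)
Lemma scaled_rat_gap (R : realType) (kmin kmax l sigma x y t : R) :
  let z := t * x + (1 - t) * y in
  x + l != 0 -> y + l != 0 -> z + l != 0 ->
  scaled_rat kmin kmax l sigma z -
  (t * scaled_rat kmin kmax l sigma x
   + (1 - t) * scaled_rat kmin kmax l sigma y) =
  sigma * (kmax - kmin) * l ^+ 2 * (t * (1 - t)) * (x - y) ^+ 2 /
  ((x + l) * (y + l) * (z + l)).
Proof.
move=> z xl yl zl; move: zl; rewrite /scaled_rat /s_rat /z => zl.
by field; rewrite xl yl zl.
Qed.

Lemma secant_slope_gt0 (R : realType) (kmin kmax l sigma x y : R) :
  0 <= kmin -> kmin < kmax -> 0 < l -> 0 < sigma -> 0 <= x -> 0 <= y ->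
  0 < secant_slope kmin kmax l sigma x y.
Proof.
move=> kmin0 kminmax l0 sigma0 x0 y0.
rewrite mulr_gt0// ltr_wpDl// mulr_gt0 ?subr_gt0// divr_gt0 ?exprn_gt0//.
by rewrite mulr_gt0// ltr_wpDl.
Qed.

(** The slope is largest at x = y = 0, where it equals sigma * kmax. *)
Lemma secant_slope_le (R : realType) (kmin kmax l sigma x y : R) :
  kmin <= kmax -> 0 < l -> 0 <= sigma -> 0 <= x -> 0 <= y ->
  secant_slope kmin kmax l sigma x y <= sigma * kmax.
Proof.
move=> kminmax l0 sigma0 x0 y0; rewrite ler_wpM2l//.
have ratio_le1 : l ^+ 2 / ((x + l) * (y + l)) <= 1.
  rewrite ler_pdivrMr ?mul1r; last by rewrite mulr_gt0// ltr_wpDl.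
  by rewrite expr2 ler_pM ?lerDr// ltW.
by rewrite -[leRHS](subrKC kmin) lerD2l -[leRHS]mulr1 ler_wpM2l// subr_ge0//.
Qed.

Lemma klipschitz_within_continuous (R : realType) (k : R) (A : set R)
    (f : R -> R) :
  k.-lipschitz_A f -> {within A, continuous f}.
Proof.
move=> lipf; apply/subspace_continuousP => x Ax.
apply/cvgrPdist_lt => e e0; rewrite near_withinE.
(* k may be 0 or negative, so the radius is taken with `|k| + 1. *)
have k1_gt0 : 0 < `|k| + 1 by rewrite ltr_wpDl.
have ek0 : 0 < e / (`|k| + 1) by rewrite divr_gt0.
have xball : \forall y \near x, `|x - y| < e / (`|k| + 1).
  by move/cvgrPdist_lt: (@cvg_id _ (nbhs x)); apply.
apply: filterS xball => y xy Ay.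
have /= := lipf (x, y) (conj Ax Ay); move/le_lt_trans; apply.
apply: (@le_lt_trans _ _ ((`|k| + 1) * `|x - y|)).
  by rewrite ler_wpM2r// (le_trans (ler_norm k))// lerDl.
by rewrite mulrC -ltr_pdivlMr.
Qed.

Lemma scaled_rat_klipschitz (R : realType) (kmin kmax l sigma : R) :
  0 <= kmin -> kmin < kmax -> 0 < l -> 0 < sigma ->
  (sigma * kmax).-lipschitz_(nonnegatives R) (scaled_rat kmin kmax l sigma).
Proof.
move=> kmin0 kminmax l0 sigma0 [x y] [/= x0 y0].
rewrite scaled_ratB ?gt_eqF ?ltr_wpDl// normrM ler_wpM2r//.
by rewrite gtr0_norm ?secant_slope_gt0// secant_slope_le// ltW.
Qed.

Lemma scaled_rat_increasing (R : realType) (kmin kmax l sigma : R) :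
  0 <= kmin -> kmin < kmax -> 0 < l -> 0 < sigma ->
  {in nonnegatives R &, {homo scaled_rat kmin kmax l sigma : x y / x < y}}.
Proof.
move=> kmin0 kminmax l0 sigma0 x y /set_mem x0 /set_mem y0 xy.
rewrite -subr_gt0 scaled_ratB ?gt_eqF ?ltr_wpDl//.
by rewrite mulr_gt0 ?subr_gt0// secant_slope_gt0.
Qed.

Lemma scaled_rat_strictly_concave (R : realType) (kmin kmax l sigma : R) :
  kmin < kmax -> 0 < l -> 0 < sigma ->
  strictly_concave_on (nonnegatives R) (scaled_rat kmin kmax l sigma).
Proof.
move=> kminmax l0 sigma0 x y /set_mem x0 /set_mem y0 xy t /andP[t0 t1].
have t'0 : 0 < 1 - t by rewrite subr_gt0.
have z0 : 0 <= t * x + (1 - t) * y by rewrite addr_ge0// mulr_ge0// ltW.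
rewrite -subr_gt0 scaled_rat_gap ?gt_eqF ?ltr_wpDl//.
have xy2 : 0 < (x - y) ^+ 2 by rewrite exprn_even_gt0//= subr_eq0.
have l2 : 0 < l ^+ 2 by rewrite exprn_gt0.
have c0 : 0 < kmax - kmin by rewrite subr_gt0.
rewrite divr_gt0//; last by rewrite !mulr_gt0// ltr_wpDl.
exact: mulr_gt0 (mulr_gt0 (mulr_gt0 (mulr_gt0 sigma0 c0) l2) (mulr_gt0 t0 t'0)) xy2.
Qed.

Lemma scaled_rat0 (R : realType) (kmin kmax l sigma : R) :
  scaled_rat kmin kmax l sigma 0 = 0.
Proof. by rewrite /scaled_rat !mulr0. Qed.

Theorem lemma4 (R : realType) (kmin kmax l : R)
    (hkmin : 0 <= kmin) (hk : kmin < kmax) (hl : 0 < l)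
    (sigma : R) (hsigma : 0 < sigma) :
  let alpha_l := fun v : R => sigma * v in
  let alpha := fun v : R => s_rat kmin kmax l v * alpha_l v in
  class_K_cave alpha /\ locally_lipschitz_on (nonnegatives R) alpha.
Proof.
move=> alpha_l alpha; rewrite -[alpha]/(scaled_rat kmin kmax l sigma).
have lip := @scaled_rat_klipschitz R kmin kmax l sigma hkmin hk hl hsigma.
have incr := @scaled_rat_increasing R kmin kmax l sigma hkmin hk hl hsigma.
split; [split; [split|]|].
- move=> x; rewrite /nonnegatives/= le_eqVlt => /predU1P[<-|x0].
    by rewrite scaled_rat0.
  rewrite -[leLHS](scaled_rat0 R kmin kmax l sigma) ltW//.
  by apply: incr => //; rewrite inE /nonnegatives//=; exact: ltW.
- exact: klipschitz_within_continuous lip.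
- exact: incr.
- exact: scaled_rat0.
- exact: scaled_rat_strictly_concave.
- apply: lipschitz_locally; apply: klipschitzW lip.
  by apply: (@globally_properfilter _ _ (0, 0)); split; exact: lexx.
Qed.
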